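(* The class of all finite integer-valued antipodal metric spaces of diameter 3 has coherent EPPA: for every such space $\mathbf A$ there exist a finite integer-valued antipodal metric space $\mathbf B$ of diameter 3 containing $\mathbf A$ as a subspace, and a map $f\mapsto\hat f$ from the set of partial automorphisms of $\mathbf A$ to $\mathrm{Aut}(\mathbf B)$ such that each $\hat f$ extends $f$ and, whenever $(f,g,h)$ is a coherent triple of partial automorphisms of $\mathbf A$, the triple $(\hat f,\hat g,\hat h)$ is coherent.
   Context: An integer-valued metric space of diameter 3 is a metric space in which the distance between any two distinct points is 1, 2 or 3. It is antipodal if (1) it contains no triangle with distances $2,2,3$, and (2) the pairs at distance 3 form a perfect matching (every point has exactly one antipodal point at distance 3). Subspaces are induced. A partial automorphism of such a space is an isometry between two subspaces, where the domain and range are required to be closed under taking antipodal points. A triple $(f,g,h)$ of partial bijections is coherent if $\mathrm{Dom}(f)=\mathrm{Dom}(h)$, $\mathrm{Range}(f)=\mathrm{Dom}(g)$, $\mathrm{Range}(g)=\mathrm{Range}(h)$ and $h=g\circ f$. *)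

(* Defs.v *)
From mathcomp Require Import all_boot all_fingroup.

Set Implicit Arguments.
Unset Strict Implicit.
Unset Printing Implicit Defensive.

(* Distances between distinct points are 1, 2 or 3, so [nat] loses nothing
   with respect to integer-valued metrics; the empty space is allowed. *)
Record antipodalSpace := AntipodalSpace {
  carrier :> finType;
  dist : carrier -> carrier -> nat;
  dist_eq0 : forall x y, dist x y = 0 <-> x = y;
  distC : forall x y, dist x y = dist y x;
  dist_triangle : forall x y z, dist x z <= dist x y + dist y z;
  dist_values : forall x y, x <> y -> dist x y \in [:: 1; 2; 3];
  no_triangle223 : forall x y z,
    ~ [/\ dist x y = 2, dist y z = 2 & dist x z = 3];
  dist3_matching : forall x, exists! y, dist x y = 3
}.

Section PartialMaps.
Variable T : finType.
Implicit Types f g h : T -> option T.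

(* [f x = Some y] means that [f] is defined at [x] with value [y]. *)
Definition pdom f : {set T} := [set x | f x != None].
Definition prange f : {set T} := [set y | [exists x, f x == Some y]].

Definition partial_bijection f : bool :=
  [forall x in pdom f, forall y in pdom f, (f x == f y) ==> (x == y)].

Definition coherent f g h : Prop :=
  [/\ pdom f = pdom h, prange f = pdom g, prange g = prange h
    & h =1 pcomp g f].

Definition total_pmap (s : {perm T}) : T -> option T := fun x => Some (s x).

End PartialMaps.

Section Automorphisms.
Variable A : antipodalSpace.

Definition antipodal_closed (S : {set A}) : bool :=
  [forall x in S, forall y, (dist x y == 3) ==> (y \in S)].

Definition partial_isometry (f : A -> option A) : bool :=
  partial_bijection f &&
  [forall x, forall y, forall x', forall y',
    (f x == Some x') && (f y == Some y') ==> (dist x' y' == dist x y)].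

Definition partialAut : {set {ffun A -> option A}} :=
  [set f : {ffun A -> option A} |
    [&& partial_isometry f, antipodal_closed (pdom f)
      & antipodal_closed (prange f)]].

Definition isomAut : {set {perm A}} :=
  [set s : {perm A} | [forall x, forall y, dist (s x) (s y) == dist x y]].

End Automorphisms.

(* Injectivity of [e] follows from [dist_eq0]. *)
Definition isometric_embedding (A B : antipodalSpace) (e : A -> B) : Prop :=
  forall x y, dist (e x) (e y) = dist x y.

Definition extends_along (A B : antipodalSpace) (e : A -> B)
    (s : {perm B}) (f : A -> option A) : Prop :=
  forall x y, f x = Some y -> s (e x) = e y.

(* Main.v *)
(* An antipodal space is a double cover of the complete graph on its antipodal
   pairs: distances between different pairs are 1 or 2, and passing to an
   antipode exchanges the two.  Let M be the set of pairs of A, and let B have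
   the vertices (e, c) with e in M and c : M -> Z/2, the antipode of (e, c)
   being (e, c + 1), and all remaining distances being 1 + (c(k) + c'(e)) for
   (e, c) and (k, c').  Permutations of M act on B, and so do the switchings
   that add s(e, k) to c(k) for a symmetric s : M * M -> Z/2.  A partial
   automorphism f of A induces a partial permutation of M, which extends to M
   coherently.  If e is in the domain, the values s(e, k) are forced by f for
   all k; they are consistent because f preserves distances.  Setting s = 0
   when neither pair is in the domain makes the lift coherent.

   Pairs are encoded by a representative, so that M becomes a subset of A, and
   elements of A that are not representatives serve as harmless extra
   indices. *)

Require Import Defs.
From mathcomp Require Import all_boot all_fingroup.

Set Implicit Arguments.
Unset Strict Implicit.
Unset Printing Implicit Defensive.

(** * Coherent extension of partial bijections of a finite set *)

Section ExtendPartialBijection.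
Variable T : finType.
Implicit Types (f g h : T -> option T) (F G H : T -> T).

(** The default [1] makes this total in [F], so that [extend] and [hat] take no proof argument. *)
Definition to_perm F : {perm T} :=
  odflt 1%g [pick s : {perm T} | [forall x, s x == F x]].

Lemma to_permE F : injective F -> to_perm F =1 F.
Proof.
move=> injF x; rewrite /to_perm; case: pickP => [s /forallP /(_ x) /eqP //|].
by move/(_ (perm injF)) => /negP []; apply/forallP => y; rewrite permE.
Qed.

Lemma to_perm_comp F G H : injective F -> injective G -> injective H ->
  (forall x, H x = G (F x)) -> forall x, to_perm H x = to_perm G (to_perm F x).
Proof. by move=> injF injG injH HE x; rewrite !to_permE. Qed.

Lemma pdomP f x : reflect (exists y, f x = Some y) (x \in pdom f).
Proof.
by rewrite inE; case: (f x) => [y|]; constructor; [exists y | case].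
Qed.

Lemma prangeP f y : reflect (exists x, f x = Some y) (y \in prange f).
Proof.
rewrite inE; apply: (iffP existsP) => -[x E]; exists x; exact/eqP.
Qed.

Lemma partial_bijectionP f :
  reflect (forall x y z, f x = Some z -> f y = Some z -> x = y)
          (partial_bijection f).
Proof.
apply: (iffP idP) => [/forall_inP bf x y z fx fy | bf].
  have xf : x \in pdom f by apply/pdomP; exists z.
  have yf : y \in pdom f by apply/pdomP; exists z.
  by have /forall_inP/(_ y yf) := bf x xf; rewrite fx fy eqxx => /eqP.
apply/forall_inP => x /pdomP [z fx]; apply/forall_inP => y _.
by apply/implyP => /eqP E; apply/eqP/(bf x y z); rewrite -?E.
Qed.

Lemma card_prange f : partial_bijection f -> #|prange f| = #|pdom f|.
Proof.
move=> /partial_bijectionP bf.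
have inj : {in pdom f &, injective (fun x => odflt x (f x))}.
  move=> x y /pdomP [a fx] /pdomP [b fy]; rewrite fx fy /= => E.
  by apply: (bf x y a); rewrite // fy E.
rewrite -(card_in_imset inj); apply: eq_card => y.
apply/prangeP/imsetP => [[x fx]|[x /pdomP [a fx] ->]].
  by exists x; [apply/pdomP; exists y | rewrite fx].
by exists x; rewrite fx.
Qed.

(* The points outside the domain are sent to those outside the range in
   increasing order of enumeration, which makes the choice compatible with
   composition. *)
Definition extend_fun f x :=
  if f x is Some y then y
  else nth x (enum (~: prange f)) (index x (enum (~: pdom f))).

Definition extend f : {perm T} := to_perm (extend_fun f).

(** Domain and range have the same size, hence so do their complements: the default of [nth] is
    never reached. *)
Lemma index_undef f x : partial_bijection f -> f x = None ->
  index x (enum (~: pdom f)) < size (enum (~: prange f)).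
Proof.
move=> bf fx; have -> : size (enum (~: prange f)) = size (enum (~: pdom f)).
  by rewrite -!cardE [LHS]cardsCs [RHS]cardsCs !setCK (card_prange bf).
by rewrite index_mem mem_enum !inE fx.
Qed.

Lemma extend_fun_undef f x : partial_bijection f -> f x = None ->
  extend_fun f x \notin prange f.
Proof.
move=> bf fx; rewrite -in_setC -mem_enum /extend_fun fx.
exact/mem_nth/index_undef.
Qed.

Lemma extend_fun_inj f : partial_bijection f -> injective (extend_fun f).
Proof.
move=> bf x y; case fx: (f x) => [a|]; case fy: (f y) => [b|].
- rewrite /extend_fun fx fy => E.
  by apply: (partial_bijectionP _ bf x y a); rewrite // fy E.
- have := extend_fun_undef bf fy => /negP N E; case: N; rewrite -E.
  by apply/prangeP; exists x; rewrite fx /extend_fun fx.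
- have := extend_fun_undef bf fx => /negP N E; case: N; rewrite E.
  by apply/prangeP; exists y; rewrite fy /extend_fun fy.
rewrite /extend_fun fx fy (set_nth_default y) ?index_undef // => /eqP.
rewrite nth_uniq ?index_undef ?enum_uniq // => /eqP E.
have ux : x \in enum (~: pdom f) by rewrite mem_enum !inE fx.
have uy : y \in enum (~: pdom f) by rewrite mem_enum !inE fy.
by rewrite -(nth_index x ux) E nth_index.
Qed.

Lemma extendE f : partial_bijection f -> extend f =1 extend_fun f.
Proof. by move/extend_fun_inj/to_permE. Qed.

Lemma extend_def f x y : partial_bijection f -> f x = Some y -> extend f x = y.
Proof. by move=> bf fx; rewrite extendE // /extend_fun fx. Qed.

Lemma mem_extend_prange f x : partial_bijection f ->
  (extend f x \in prange f) = (x \in pdom f).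
Proof.
move=> bf; apply/idP/pdomP => [|[y fx]].
  case fx: (f x) => [y|]; first by exists y.
  by rewrite extendE // (negPf (extend_fun_undef bf fx)).
by rewrite (extend_def bf fx); apply/prangeP; exists x.
Qed.

(** The i-th point outside [pdom f] goes to the i-th point outside [prange f], which equals
    [pdom g], and from there to the i-th point outside [prange g]: positions in the enumerations are
    preserved. *)
Lemma extend_coherent f g h :
    partial_bijection f -> partial_bijection g -> partial_bijection h ->
  coherent f g h -> forall x, extend h x = extend g (extend f x).
Proof.
move=> bf bg bh [dfh rfg rgh hE] x.
case fx: (f x) => [y|].
  have /pdomP [z hx] : x \in pdom h by rewrite -dfh; apply/pdomP; exists y.
  have gy : g y = Some z by rewrite -hx hE /pcomp /= fx.
  by rewrite (extend_def bh hx) (extend_def bf fx) (extend_def bg gy).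
have hx : h x = None by rewrite hE /pcomp /= fx.
have gfx : g (extend f x) = None.
  have := mem_extend_prange x bf; rewrite rfg !inE fx eqxx.
  by case: (g _).
rewrite (extendE bh) (extendE bg) /extend_fun hx gfx -rgh -dfh.
have -> : index (extend f x) (enum (~: pdom g)) = index x (enum (~: pdom f)).
  rewrite extendE // /extend_fun fx -rfg index_uniq ?enum_uniq //.
  exact: index_undef.
apply: set_nth_default; rewrite dfh rgh; exact: index_undef.
Qed.

Lemma total_pmap_coherent (s t r : {perm T}) :
  (forall x, r x = t (s x)) ->
  coherent (total_pmap s) (total_pmap t) (total_pmap r).
Proof.
have dT (s' : {perm T}) : pdom (total_pmap s') = setT.
  by apply/setP => x; rewrite !inE.
have rT (s' : {perm T}) : prange (total_pmap s') = setT.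
  apply/setP => x; rewrite in_setT; apply/prangeP; exists (s'^-1%g x).
  by rewrite /total_pmap permKV.
by move=> rE; split; rewrite ?dT ?rT // => x; rewrite /total_pmap rE.
Qed.

End ExtendPartialBijection.

(** * Antipodes, representatives and binary coordinates in [A] *)

Section Construction.
Variable A : antipodalSpace.
Implicit Types (x y e k : A) (f g h : {ffun A -> option A}).

(** Distance 3 counts as far, so that [far_anti] holds without exceptional pairs. *)
Definition far x y := 1 < dist x y.

Lemma distxx x : dist x x = 0. Proof. exact/dist_eq0. Qed.

Lemma farxx x : far x x = false. Proof. by rewrite /far distxx. Qed.

Lemma farC x y : far x y = far y x. Proof. by rewrite /far distC. Qed.

Definition anti x := odflt x [pick y | dist x y == 3].

Lemma dist_anti x : dist x (anti x) = 3.
Proof.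
rewrite /anti; case: pickP => [y /eqP //|no3].
by have [y [/eqP]] := dist3_matching x; rewrite no3.
Qed.

Lemma dist3E x y : dist x y = 3 -> y = anti x.
Proof.
by have [z [_ U]] := dist3_matching x => /U <-; apply: U; exact: dist_anti.
Qed.

Lemma antiK : involutive anti.
Proof. by move=> x; apply/esym/dist3E; rewrite distC dist_anti. Qed.

Lemma anti_neq x : anti x != x.
Proof. by apply/eqP => E; have := dist_anti x; rewrite E distxx. Qed.

Lemma dist_generic x y : y != x -> y != anti x -> dist x y = (far x y).+1.
Proof.
move=> /eqP nyx /eqP nya; rewrite /far.
have := dist_values (fun E : x = y => nyx (esym E)); rewrite !inE.
by case/or3P => /eqP // D; try (by rewrite D); case: nya; apply: dist3E.
Qed.

(** Off the pair of [x], distances 2 and 2 from [y] to [x] and [anti x] form the excluded triangle,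
    and 1 and 1 violate the triangle inequality. *)
Lemma far_anti x y : far (anti x) y = ~~ far x y.
Proof.
have [->|nyx] := eqVneq y x; first by rewrite farxx farC /far dist_anti.
have [->|nya] := eqVneq y (anti x); first by rewrite farxx /far dist_anti.
have Dx := dist_generic nyx nya.
have Da : dist (anti x) y = (far (anti x) y).+1.
  by apply: dist_generic; rewrite ?antiK.
case fx: (far x y) Dx => /= Dx; case fa: (far (anti x) y) Da => //= Da.
  by case: (@no_triangle223 _ x y (anti x)); rewrite Dx dist_anti distC Da.
by have := dist_triangle x y (anti x); rewrite dist_anti Dx distC Da.
Qed.

Definition rep x := if enum_rank x <= enum_rank (anti x) then x else anti x.

Definition flipped x := rep x != x.

Lemma rep_or x : rep x = x \/ rep x = anti x.
Proof. by rewrite /rep; case: ifP; [left | right]. Qed.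

Lemma rep_anti x : rep (anti x) = rep x.
Proof.
rewrite /rep antiK; case: ltngtP => // /ord_inj /enum_rank_inj E.
by have := anti_neq x; rewrite E eqxx.
Qed.

Lemma rep_id x : rep (rep x) = rep x.
Proof. by case: (rep_or x) => E; rewrite {1}E ?rep_anti. Qed.

Lemma flipped_anti x : flipped (anti x) = ~~ flipped x.
Proof.
rewrite /flipped rep_anti.
case: (rep_or x) => ->; rewrite eqxx; last by rewrite anti_neq.
by rewrite eq_sym anti_neq.
Qed.

Lemma rep_flipped_inj x y : rep x = rep y -> flipped x = flipped y -> x = y.
Proof.
have : rep x = rep y -> x = y \/ x = anti y.
  case: (rep_or x) => ->; case: (rep_or y) => -> E.
  - by left.
  - by right.
  - by right; rewrite -E antiK.
  - by left; apply: (can_inj antiK).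
by move=> H /H [//|->]; rewrite flipped_anti; case: (flipped y).
Qed.

Lemma far_rep x y : far (rep x) y = flipped x (+) far x y.
Proof.
rewrite /flipped; case: (rep_or x) => ->; first by rewrite eqxx.
by rewrite anti_neq far_anti.
Qed.

(* For distinct pairs, the bit of [far] is charged to the pair of smaller
   rank only. *)
Definition chi x k :=
  flipped x (+) ((enum_rank (rep x) < enum_rank k) && far (rep x) k).

Lemma chi_anti x k : chi (anti x) k = ~~ chi x k.
Proof. by rewrite /chi rep_anti flipped_anti addNb. Qed.

Lemma chi_rep x : chi x (rep x) = flipped x.
Proof. by rewrite /chi ltnn addbF. Qed.

(** For distinct representatives exactly one of the two rank comparisons holds, so the bit of [far]
    is counted once; for equal ones it vanishes. *)
Lemma chi_sum x y : chi x (rep y) (+) chi y (rep x) = far x y.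
Proof.
have -> : far x y = flipped x (+) flipped y (+) far (rep x) (rep y).
  rewrite far_rep (farC x (rep y)) far_rep (farC y).
  by case: (flipped x); case: (flipped y); case: (far x y).
rewrite /chi (farC (rep y)); case: ltngtP => [_|_|/ord_inj /enum_rank_inj ->].
- by case: (flipped x); case: (flipped y); case: (far _ _).
- by case: (flipped x); case: (flipped y); case: (far _ _).
by rewrite farxx !andbF !addbF.
Qed.

(** * The finite antipodal space [B] *)

Let vertex := (A * {ffun A -> bool})%type.
Implicit Types u v w : vertex.

Definition neg u : vertex := (u.1, [ffun k => ~~ u.2 k]).

Definition farB u v := u.2 v.1 (+) v.2 u.1.

Definition distB u v :=
  if v == u then 0 else if v == neg u then 3 else (farB u v).+1.

Lemma negK : involutive neg.
Proof.
by case=> e c; congr (_, _); apply/ffunP => k; rewrite !ffunE negbK.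
Qed.

Lemma neg_neq u : (neg u == u) = false.
Proof.
apply/eqP => /(congr1 (fun v => v.2 u.1)); rewrite ffunE.
by case: (u.2 u.1).
Qed.

Lemma farBC u v : farB u v = farB v u.
Proof. exact: addbC. Qed.

Lemma farB_neg u v : farB u (neg v) = ~~ farB u v.
Proof. by rewrite /farB ffunE addbN. Qed.

Lemma eq_negC u v : (v == neg u) = (u == neg v).
Proof. by rewrite -(inj_eq (can_inj negK)) negK eq_sym. Qed.

Lemma distB_neg u : distB u (neg u) = 3.
Proof. by rewrite /distB neg_neq eqxx. Qed.

Lemma distB_eq0 u v : distB u v = 0 <-> u = v.
Proof.
rewrite /distB; split=> [|->]; last by rewrite eqxx.
by case: eqP => [->|_] //; case: ifP.
Qed.

Lemma distBC u v : distB u v = distB v u.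
Proof. by rewrite /distB eq_sym (eq_negC u) farBC. Qed.

Lemma distB_leq3 u v : distB u v <= 3.
Proof. by rewrite /distB; do 2?case: ifP => // _; case: (farB _ _). Qed.

Lemma distB3 u v : distB u v = 3 -> v = neg u.
Proof.
by rewrite /distB; case: ifP => // _; case: eqP => // _; case: (farB _ _).
Qed.

(** Passing to the antipode exchanges 1 and 2; this settles both the triangle inequality across an
    antipodal pair and the excluded triangle. *)
Lemma distB_negr u v : u != v -> v != neg u ->
  distB u v + distB v (neg u) = 3.
Proof.
move=> nuv nvu; rewrite {1}/distB eq_sym (negPf nuv) (negPf nvu).
rewrite /distB eq_sym (negPf nvu) (inj_eq (can_inj negK)) (negPf nuv).
by rewrite farB_neg farBC; case: (farB _ _).
Qed.

Lemma distB_triangle u v w : distB u w <= distB u v + distB v w.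
Proof.
have [->|nuv] := eqVneq u v; first exact: leq_addl.
have [->|nvw] := eqVneq v w; first exact: leq_addr.
have [wu|nwu] := eqVneq w (neg u).
  have [->|nvu] := eqVneq v (neg u).
    by rewrite distB_neg (leq_trans (distB_leq3 _ _)) ?leq_addr.
  by rewrite wu distB_negr // distB_neg.
(* Otherwise the left side is at most 2, while both summands are positive. *)
have pos (a b : vertex) : a != b -> 0 < distB a b.
  by move=> nab; rewrite lt0n; apply: contra nab => /eqP /distB_eq0 ->.
apply: leq_trans (leq_add (pos _ _ nuv) (pos _ _ nvw)).
by rewrite {1}/distB (negPf nwu); case: ifP => // _; case: (farB _ _).
Qed.

Lemma distB_values u v : u <> v -> distB u v \in [:: 1; 2; 3].
Proof.
move=> nuv; rewrite /distB; case: eqP => [E|_]; first by case: nuv.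
by case: ifP => // _; case: (farB _ _).
Qed.

Lemma distB_no223 u v w :
  ~ [/\ distB u v = 2, distB v w = 2 & distB u w = 3].
Proof.
case=> Duv Dvw /distB3 E; subst w.
have nuv : u != v by apply/eqP => /distB_eq0; rewrite Duv.
have nvu : v != neg u by apply/eqP => /distB_eq0; rewrite Dvw.
by have := distB_negr nuv nvu; rewrite Duv Dvw.
Qed.

Lemma distB_matching u : exists! v, distB u v = 3.
Proof.
by exists (neg u); split=> [|v /distB3 //]; rewrite distB_neg.
Qed.

Definition spaceB : antipodalSpace :=
  AntipodalSpace distB_eq0 distBC distB_triangle distB_values distB_no223
    distB_matching.

(** * Embedding of [A] into [B] *)

Definition embed x : vertex := (rep x, [ffun k => chi x k]).

Lemma embed_inj : injective embed.
Proof.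
(* The coordinate at its own pair tells a point from its antipode. *)
move=> x y [Er /ffunP /(_ (rep x))]; rewrite !ffunE {2}Er !chi_rep.
exact: rep_flipped_inj.
Qed.

Lemma embed_anti x : embed (anti x) = neg (embed x).
Proof.
rewrite /embed /neg rep_anti; congr (_, _).
by apply/ffunP => k; rewrite !ffunE chi_anti.
Qed.

Lemma distB_embed x y : distB (embed x) (embed y) = dist x y.
Proof.
rewrite /distB -embed_anti !(inj_eq embed_inj).
case: eqVneq => [->|nyx]; first by rewrite distxx.
case: eqVneq => [->|nya]; first by rewrite dist_anti.
by rewrite dist_generic // /farB !ffunE chi_sum.
Qed.

(** * Partial automorphisms and the permutations they induce on pairs *)

Section PartialAutomorphism.
Variable f : {ffun A -> option A}.
Hypothesis fP : f \in partialAut A.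

Lemma partialAut_bij : partial_bijection f.
Proof. by move: fP; rewrite inE => /andP [/andP []]. Qed.

Lemma partialAut_dist x y x' y' :
  f x = Some x' -> f y = Some y' -> dist x' y' = dist x y.
Proof.
move: fP; rewrite inE => /andP [/andP [_ iso] _] fx fy.
move/forallP/(_ x)/forallP/(_ y)/forallP/(_ x')/forallP/(_ y'): iso.
by rewrite fx fy !eqxx => /eqP.
Qed.

Lemma partialAut_anti x : f (anti x) = omap anti (f x).
Proof.
have anti_dom y : y \in pdom f -> anti y \in pdom f.
  move: fP; rewrite inE => /and3P [_ /forall_inP clo _] /clo /forallP.
  by move/(_ (anti y)); rewrite dist_anti.
case fx: (f x) => [y|] /=.
  have /pdomP [z fax] : anti x \in pdom f.
    by apply: anti_dom; apply/pdomP; exists y.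
  rewrite fax; congr Some; apply: dist3E.
  by rewrite (partialAut_dist fx fax) dist_anti.
case fax: (f (anti x)) => [y|] //.
have /anti_dom : anti x \in pdom f by apply/pdomP; exists y.
by rewrite antiK inE fx.
Qed.

End PartialAutomorphism.

(** The action of [f] on pairs; elements that are not representatives stay outside the domain and
    are left to [extend]. *)
Definition rep_map f x : option A :=
  if rep x == x then omap rep (f x) else None.

Lemma rep_map_rep f x : f \in partialAut A -> rep_map f (rep x) = omap rep (f x).
Proof.
move=> fP; rewrite /rep_map rep_id eqxx.
case: (rep_or x) => ->; rewrite ?partialAut_anti //.
by case: (f x) => //= y; rewrite rep_anti.
Qed.

Lemma rep_map_some f x y : rep_map f x = Some y ->
  exists z, [/\ rep x = x, f x = Some z & y = rep z].
Proof.
rewrite /rep_map; case: eqP => // rx; case fx: (f x) => [z|] //= [<-].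
by exists z.
Qed.

Lemma rep_map_bij f : f \in partialAut A -> partial_bijection (rep_map f).
Proof.
move=> fP; apply/partial_bijectionP => x y z.
move=> /rep_map_some [a [rx fx za]] /rep_map_some [b [ry fy zb]].
have [ab|nab] := eqVneq a b.
  by apply: (partial_bijectionP _ (partialAut_bij fP) x y a); rewrite // fy ab.
(* Distinct values in one pair are antipodal, and [f] preserves distance 3, so [x] and [y] represent
   the same pair. *)
have ba : b = anti a.
  apply: rep_flipped_inj; rewrite ?rep_anti -?za -?zb // flipped_anti.
  case E: (flipped b == flipped a); last by move: E; do 2!case: (flipped _).
  by case/eqP: nab; apply: rep_flipped_inj; rewrite -?za -?zb // (eqP E).
have yE : y = anti x.
  by apply: dist3E; rewrite -(partialAut_dist fP fx fy) ba dist_anti.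
by rewrite -rx -ry yE rep_anti.
Qed.

Lemma rep_map_coherent f g h :
    f \in partialAut A -> g \in partialAut A -> h \in partialAut A ->
  coherent f g h -> coherent (rep_map f) (rep_map g) (rep_map h).
Proof.
move=> fP gP hP [dfh rfg rgh hE].
have domE f' x : (x \in pdom (rep_map f')) = (rep x == x) && (x \in pdom f').
  by rewrite !inE /rep_map; case: (rep x == x); case: (f' x).
have ranE f' y : f' \in partialAut A ->
    (y \in prange (rep_map f')) = (rep y == y) && (y \in prange f').
  move=> f'P; apply/prangeP/andP => [[x /rep_map_some [z [_ fx ->]]]|].
    rewrite rep_id; split=> //; apply/prangeP.
    case: (rep_or z) => ->; first by exists x.
    (* If the representative of [z] is [anti z], it is the value at [anti x]. *)
    by exists (anti x); rewrite partialAut_anti // fx.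
  case=> /eqP ry /prangeP [x fx]; exists (rep x).
  by rewrite rep_map_rep // fx /= ry.
split; try by apply/setP => x; rewrite ?domE ?ranE ?domE ?dfh ?rfg ?rgh.
move=> x; rewrite /pcomp; have [rx|nrx] := eqVneq (rep x) x.
  rewrite -rx !rep_map_rep // hE /pcomp.
  by case: (f x) => //= y; rewrite rep_map_rep.
by rewrite /rep_map (negPf nrx).
Qed.

Definition base f : {perm A} := extend (rep_map f).

Lemma base_rep f x y : f \in partialAut A -> f x = Some y ->
  base f (rep x) = rep y.
Proof.
move=> fP fx; apply: extend_def; first exact: rep_map_bij.
by rewrite rep_map_rep // fx.
Qed.

Lemma base_coherent f g h :
    f \in partialAut A -> g \in partialAut A -> h \in partialAut A ->
  coherent f g h -> forall x, base h x = base g (base f x).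
Proof.
move=> fP gP hP coh; apply: extend_coherent; rewrite ?rep_map_bij //.
exact: rep_map_coherent.
Qed.

(** * Switchings and their symmetry *)

(* The switch needed for the lift of [f] to extend [f] on the pair of [e]. *)
Definition shift f e k :=
  if f e is Some a then chi a (base f k) (+) chi e k else false.

(** Passing to the antipode complements both [chi] terms, which leaves their sum unchanged. *)
Lemma shift_rep f x k : f \in partialAut A -> shift f (rep x) k = shift f x k.
Proof.
move=> fP; rewrite /shift; case: (rep_or x) => -> //.
rewrite partialAut_anti //; case: (f x) => //= y; rewrite !chi_anti.
by rewrite addbN addNb negbK.
Qed.

Definition switch f e k :=
  if e \in pdom (rep_map f) then shift f e k
  else (k \in pdom (rep_map f)) && shift f k e.

Lemma switchC f e k : f \in partialAut A -> switch f e k = switch f k e.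
Proof.
move=> fP; rewrite /switch; case: ifP => [ef|_]; last by case: ifP.
case: ifP => //= kf.
have /pdomP [_ /rep_map_some [a [re fe _]]] := ef.
have /pdomP [_ /rep_map_some [b [rk fk _]]] := kf.
rewrite -[in RHS]re -[in LHS]rk /shift fe fk (base_rep fP fe) (base_rep fP fk).
(* With both pairs in the domain, symmetry amounts to [far a b = far e k]. *)
have := chi_sum a b; have := chi_sum e k.
rewrite /far (partialAut_dist fP fe fk) => <-.
by do 4!case: (chi _ _).
Qed.

(** * Lifts to automorphisms of [B] and their coherence *)

Definition hat_fun f u : vertex :=
  (base f u.1,
   [ffun k => let k' := (base f)^-1%g k in u.2 k' (+) switch f u.1 k']).

Lemma hat_fun_coord f u k :
  (hat_fun f u).2 (base f k) = u.2 k (+) switch f u.1 k.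
Proof. by rewrite ffunE /= permK. Qed.

Lemma hat_fun_eq f u v : base f u.1 = v.1 ->
  (forall k, v.2 (base f k) = u.2 k (+) switch f u.1 k) -> hat_fun f u = v.
Proof.
case: v => e c /= <- E; congr (_, _); apply/ffunP => k.
by rewrite ffunE /= -E permKV.
Qed.

Lemma hat_fun_inj f : injective (hat_fun f).
Proof.
move=> u v E; have E1 : u.1 = v.1 by move/(congr1 fst): E => /perm_inj.
rewrite (surjective_pairing u) (surjective_pairing v) E1; congr (_, _).
apply/ffunP => k; move/(congr1 (fun w => w.2 (base f k))): E.
by rewrite !hat_fun_coord E1 => /addIb.
Qed.

Lemma hat_fun_neg f u : hat_fun f (neg u) = neg (hat_fun f u).
Proof. by congr (_, _); apply/ffunP => k; rewrite !ffunE /= !ffunE addNb. Qed.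

(** The two switch bits agree by symmetry and cancel. *)
Lemma hat_fun_farB f u v : f \in partialAut A ->
  farB (hat_fun f u) (hat_fun f v) = farB u v.
Proof.
move=> fP; rewrite /farB !hat_fun_coord (switchC _ _ fP).
by case: (switch _ _ _); do 2!case: (fun_of_fin _ _).
Qed.

Definition hat f : {perm spaceB} := to_perm (hat_fun f : spaceB -> spaceB).

Lemma hatE f : hat f =1 hat_fun f.
Proof. exact/to_permE/hat_fun_inj. Qed.

Lemma hat_isom f : f \in partialAut A -> hat f \in isomAut spaceB.
Proof.
move=> fP; rewrite inE; apply/forallP => u; apply/forallP => v; apply/eqP.
rewrite !hatE /= /distB -hat_fun_neg !(inj_eq (@hat_fun_inj f)).
by rewrite hat_fun_farB.
Qed.

Lemma hat_extends f : f \in partialAut A ->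
  extends_along (embed : A -> spaceB) (hat f) f.
Proof.
move=> fP x y fx; rewrite hatE /embed.
apply: hat_fun_eq => [|k]; first exact: base_rep.
rewrite /= !ffunE /switch.
have -> : rep x \in pdom (rep_map f).
  by apply/pdomP; exists (rep y); rewrite rep_map_rep // fx.
rewrite shift_rep // /shift fx.
(* Adding the shift to [chi x k] cancels it and leaves [chi y (base f k)]. *)
by do 2!case: (chi _ _).
Qed.

(** The sum telescopes: the term [chi a (base f k)], with [a] the image of [e], occurs twice. *)
Lemma shift_coherent f g h e k :
    f \in partialAut A -> g \in partialAut A -> h \in partialAut A ->
    coherent f g h -> e \in pdom (rep_map f) ->
  shift h e k = shift f e k (+) shift g (base f e) (base f k).
Proof.
move=> fP gP hP coh /pdomP [_ /rep_map_some [a [re fe _]]].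
have bE := base_coherent fP gP hP coh.
have := base_rep fP fe; rewrite re => ->; rewrite shift_rep // /shift fe bE.
case: coh => dfh _ _ hE.
have /pdomP [c he] : e \in pdom h by rewrite -dfh; apply/pdomP; exists a.
have ga : g a = Some c by rewrite -he hE /pcomp /= fe.
by rewrite he ga; do 3!case: (chi _ _).
Qed.

(** As [base f] maps the domain of [rep_map f] onto that of [rep_map g], all three switches fall
    into the same case; if both pairs lie outside, all are zero. *)
Lemma switch_coherent f g h e k :
    f \in partialAut A -> g \in partialAut A -> h \in partialAut A ->
    coherent f g h ->
  switch h e k = switch f e k (+) switch g (base f e) (base f k).
Proof.
move=> fP gP hP coh; have [dfh rfg _ _] := rep_map_coherent fP gP hP coh.
rewrite /switch -dfh -rfg !mem_extend_prange ?rep_map_bij //.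
case: ifP => [ef|_]; first exact: shift_coherent.
by case kf: (k \in _) => //=; apply: shift_coherent.
Qed.

Lemma hat_fun_comp f g h u :
    f \in partialAut A -> g \in partialAut A -> h \in partialAut A ->
    coherent f g h ->
  hat_fun h u = hat_fun g (hat_fun f u).
Proof.
move=> fP gP hP coh; have bE := base_coherent fP gP hP coh.
apply: hat_fun_eq => [|k]; rewrite bE //.
by rewrite !hat_fun_coord (switch_coherent _ _ fP gP hP coh) addbA.
Qed.

Lemma hat_coherent f g h :
    f \in partialAut A -> g \in partialAut A -> h \in partialAut A ->
    coherent f g h ->
  coherent (total_pmap (hat f)) (total_pmap (hat g)) (total_pmap (hat h)).
Proof.
move=> fP gP hP coh; apply/total_pmap_coherent/to_perm_comp;
  try exact: hat_fun_inj.
by move=> u; apply: hat_fun_comp.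
Qed.

End Construction.

Theorem theorem1p4 (A : antipodalSpace) :
  exists (B : antipodalSpace) (e : A -> B)
         (hat : {ffun A -> option A} -> {perm B}),
    [/\ isometric_embedding e,
        forall f, f \in partialAut A -> hat f \in isomAut B,
        forall f, f \in partialAut A -> extends_along e (hat f) f
      & forall f g h, f \in partialAut A -> g \in partialAut A -> h \in partialAut A ->
          coherent f g h ->
          coherent (total_pmap (hat f)) (total_pmap (hat g)) (total_pmap (hat h))].
Proof.
exists (spaceB A), (@embed A), (@hat A); split.
- exact: distB_embed.
- exact: hat_isom.
- exact: hat_extends.
exact: hat_coherent.
Qed.
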